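(* Let $\mathcal{X}\subseteq\mathbb{R}^N$ and $\mathcal{Z}_m\subseteq\mathbb{R}^{J_m}$, $m\in[M]$, be non-empty, compact and convex. Let $f_0:\mathbb{R}^N\to\mathbb{R}\cup\{+\infty\}$ be convex with $\mathcal{X}\subseteq\mathrm{dom}(f_0)$, and let $g_m:\mathbb{R}^N\times\mathbb{R}^{J_m}\to\mathbb{R}\cup\{\pm\infty\}$, $m\in[M]$, be such that $g_m(\cdot,z_m)$ is convex on $\mathbb{R}^N$ for every $z_m\in\mathcal{Z}_m$, $g_m(x,\cdot)$ is concave on $\mathbb{R}^{J_m}$ for every $x\in\mathcal{X}$, and $\mathcal{X}\times\mathcal{Z}_m\subseteq\mathrm{dom}(g_m)$. Put $f_m(x)=\max_{z_m\in\mathcal{Z}_m}g_m(x,z_m)$. Assume there is $\bar x\in\mathcal{X}$ with $f_m(\bar x)<0$ for all $m\in[M]$, and that the problem $\min\{f_0(x): x\in\mathcal{X},\ f_m(x)\le 0\ \forall m\in[M]\}$ has an optimal solution. Assume further that $f_0$ is subdifferentiable on $\mathcal{X}$; that for all $m\in[M]$, $x\in\mathcal{X}$, $z_m\in\mathcal{Z}_m$ the functions $g_m(\cdot,z_m)$ and $-g_m(x,\cdot)$ are subdifferentiable on $\mathcal{X}$ and $\mathcal{Z}_m$, respectively; and that there are constants $D_0,D_1,\dots,D_M,E_1,\dots,E_M>0$ such that for all $m\in[M]$, $x\in\mathcal{X}$, $z_m\in\mathcal{Z}_m$: $\|\xi_0\|_2\le D_0$ for all $\xi_0\in\partial f_0(x)$,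 $\|\xi_m\|_2\le D_m$ for all $\xi_m\in\partial_x g_m(x,z_m)$, and $\|\zeta_m\|_2\le E_m$ for all $\zeta_m\in\partial_{z_m}(-g_m)(x,z_m)$. Let $\alpha>0$, $x^k\in\mathcal{X}$ and $\lambda^{k+1}\in\mathbb{R}^M_+$. Then there exists a constant $C_{i,1}>0$ such that if $T\ge\frac{C_{i,1}}{\nu^2}$ and $\gamma,\delta\le\frac{1}{\sqrt T}$, then the output $(\bar x_T,\bar z_T)$ of the Inner Algorithm (described in the context) is a strong $\nu$-approximate saddle point (where $\nu>0$) of the inner problem $$\min_{x\in\mathcal{X}}\max_{z\in\mathcal{Z}}\Big\{f_0(x)+\sum_{m\in[M]}\lambda_m^{k+1} g_m(x,z_m)+\frac{1}{2\alpha}\|x-x^k\|_2^2\Big\}.$$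
   Context: Notation: $[M]=\{1,\dots,M\}$; $\mathcal{Z}=\mathcal{Z}_1\times\cdots\times\mathcal{Z}_M$; $\mathrm{Proj}_{\mathcal{S}}$ is Euclidean projection onto a closed convex set $\mathcal{S}$; $\mathrm{dom}$ denotes the domain (the set where a function is finite). A function is subdifferentiable at a point if its set of subgradients there is non-empty. Strong approximate saddle point: let $\mathcal{F}:\mathcal{U}\times\mathcal{V}\to\mathbb{R}$ be $\sigma$-strongly convex in $u$ for each $v$ ($\sigma>0$ independent of $v$) and concave in $v$ for each $u$. For $\nu>0$, $(\tilde u,\tilde v)\in\mathcal{U}\times\mathcal{V}$ is a strong $\nu$-approximate saddle point of $\mathcal{F}$ if $\mathcal{F}(\tilde u,v)\le\mathcal{F}(u,\tilde v)-\frac{\sigma}{2}\|u-\tilde u\|_2^2+\nu$ for all $(u,v)\in\mathcal{U}\times\mathcal{V}$. For the inner problem, $\mathcal{F}$ is its objective, $\mathcal{U}=\mathcal{X}$, $\mathcal{V}=\mathcal{Z}$ and $\sigma=1/\alpha$. Inner Algorithm. Input: integer $T\ge1$, step sizes $\delta,\gamma>0$, $x_0\in\mathcal{X}$, $z_0\in\mathcal{Z}$, $\alpha>0$, $x^k\in\mathcal{X}$, $\lambda^{k+1}\ge0$. For $t=0,\dots,T-1$: (z-update) for each $m\in[M]$ compute $\zeta_{t,m}\in\partial_{z_m}(-g_m)(x_t,z_{t,m})$ and set $z_{t+1,m}=\mathrm{Proj}_{\mathcal{Z}_m}(z_{t,m}-\delta\lambda_m^{k+1}(2\zeta_{t,m}-\zeta_{t-1,m}))$,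 where $\zeta_{-1,m}=\zeta_{0,m}$; (x-update) compute $\xi_{t,0}\in\partial f_0(x_t)$ and $\xi_{t,m}\in\partial_x g_m(x_t,z_{t+1,m})$, $m\in[M]$; set $\xi_t=\xi_{t,0}+\sum_{m\in[M]}\lambda_m^{k+1}\xi_{t,m}$ and $x_{t+1}=\mathrm{Proj}_{\mathcal{X}}\big(\frac{\alpha\gamma}{\alpha+\gamma}(\frac1\alpha x^k+\frac1\gamma x_t-\xi_t)\big)$. Output: $\bar x_T=\frac1T\sum_{t=1}^T x_t$, $\bar z_T=\frac1T\sum_{t=1}^T z_t$.
   Formalization: The formal theorem also assumes γ, δ ≥ c/√T for an arbitrary fixed c > 0, with C_{i,1} allowed to depend on c; with only the upper bound γ, δ ≤ 1/√T the claim fails, since arbitrarily small steps barely move the iterates. *)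

(* Defs.v *)
(* MathComp-Analysis. *)
From HB Require Import structures.
From mathcomp Require Import all_boot all_order all_algebra.
From mathcomp Require Import all_classical all_reals.
From mathcomp Require Import ereal topology normedtype convex.

Import Order.TTheory GRing.Theory Num.Theory.
Import numFieldNormedType.Exports.

Local Open Scope classical_set_scope.
Local Open Scope ring_scope.

Section Euclidean.
Context {R : realType} {n : nat}.
Implicit Types (u v p : 'rV[R]_n) (S : set 'rV[R]_n) (f : 'rV[R]_n -> \bar R).

Definition dotp u v : R := \sum_i u 0 i * v 0 i.

(* The library norm `|u| on row vectors is the sup norm. *)
Definition norm2 u : R := Num.sqrt (dotp u u).

(* p = Proj_S v.  For S non-empty, closed and convex the nearest point exists
   and is unique. *)
Definition is_proj S v p : Prop :=
  S p /\ forall q, S q -> norm2 (v - p) <= norm2 (v - q).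

(* Convexity of an extended-real-valued function is convexity of its epigraph,
   which avoids the undefined sum (+oo) + (-oo). *)
Definition econvex f : Prop :=
  convex_set [set xa : 'rV[R]_n * R^o | (f xa.1 <= (xa.2 : R)%:E)%E].

Definition econcave f : Prop := econvex (fun u => - f u)%E.

Definition subdiff f u : set 'rV[R]_n :=
  [set xi | forall v, (f u + (dotp xi (v - u))%:E <= f v)%E].

Definition subdifferentiable_on S f : Prop :=
  forall u, S u -> subdiff f u !=set0.

End Euclidean.

Definition edom {R : realType} {A : Type} (f : A -> \bar R) : set A :=
  [set a | f a \is a fin_num].

(* Meant for F finite on U x V, sigma-strongly convex in its first argument and
   concave in the second. *)
Definition strong_approx_saddle {R : realType} {n : nat} {B : Type}
    (U : set 'rV[R]_n) (V : set B) (F : 'rV[R]_n -> B -> \bar R)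
    (sigma nu : R) (ut : 'rV[R]_n) (vt : B) : Prop :=
  [/\ U ut, V vt &
      forall u v, U u -> V v ->
        (F ut v <= F u vt - (sigma / 2 * norm2 (u - ut) ^+ 2)%:E + nu%:E)%E].

Section InnerProblem.
Context {R : realType} {N M : nat} {J : 'I_M -> nat}.
Local Notation Zvec := (forall m : 'I_M, 'rV[R]_(J m)).
Context (X : set 'rV[R]_N) (Z : forall m : 'I_M, set 'rV[R]_(J m)).
Context (f0 : 'rV[R]_N -> \bar R)
        (g : forall m : 'I_M, 'rV[R]_N -> 'rV[R]_(J m) -> \bar R).

Definition Zprod : set Zvec := [set z | forall m, Z m (z m)].

(* f_m(x) = max_(z in Z_m) g_m(x, z), written as a supremum in \bar R. *)
Definition robust_constraint (m : 'I_M) (x : 'rV[R]_N) : \bar R :=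
  ereal_sup [set g m x z | z in Z m].

Definition feasible : set 'rV[R]_N :=
  [set x | X x /\ forall m, (robust_constraint m x <= 0)%E].

Context (alpha : R) (xk : 'rV[R]_N) (lam : 'I_M -> R).

Definition inner_objective (x : 'rV[R]_N) (z : Zvec) : \bar R :=
  (f0 x + \sum_(m < M) (lam m)%:E * g m x (z m)
   + ((2 * alpha)^-1 * norm2 (x - xk) ^+ 2)%:E)%E.

(* A T-step run of the inner algorithm, with arbitrary choices of subgradients
   zeta, xi0, xi.  Since 0.-1 = 0, zeta t.-1 is zeta_(t-1) under the convention
   zeta_(-1) = zeta_0. *)
Record inner_run (T : nat) (gamma delta : R)
    (x : nat -> 'rV[R]_N) (z : nat -> Zvec) (zeta : nat -> Zvec)
    (xi0 : nat -> 'rV[R]_N) (xi : nat -> 'I_M -> 'rV[R]_N) : Prop := InnerRun {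
  run_x0 : X (x 0%N) ;
  run_z0 : Zprod (z 0%N) ;
  run_zeta : forall t m, (t < T)%N ->
    subdiff (fun y => - g m (x t) y)%E (z t m) (zeta t m) ;
  run_z : forall t m, (t < T)%N ->
    is_proj (Z m)
      (z t m - (delta * lam m) *: (2 *: zeta t m - zeta t.-1 m)) (z t.+1 m) ;
  run_xi0 : forall t, (t < T)%N -> subdiff f0 (x t) (xi0 t) ;
  run_xi : forall t m, (t < T)%N ->
    subdiff (fun y => g m y (z t.+1 m)) (x t) (xi t m) ;
  run_x : forall t, (t < T)%N ->
    is_proj X
      ((alpha * gamma / (alpha + gamma)) *:
         (alpha^-1 *: xk + gamma^-1 *: x t
          - (xi0 t + \sum_(m < M) lam m *: xi t m)))
      (x t.+1)
}.

End InnerProblem.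

Definition xavg {R : realType} {N : nat} (T : nat) (x : nat -> 'rV[R]_N) :
    'rV[R]_N :=
  T%:R^-1 *: \sum_(1 <= t < T.+1) x t.

Definition zavg {R : realType} {M : nat} {J : 'I_M -> nat} (T : nat)
    (z : nat -> forall m : 'I_M, 'rV[R]_(J m)) : forall m : 'I_M, 'rV[R]_(J m) :=
  fun m => xavg T (fun t => z t m).

(* Main.v *)
Require Import Defs.
From HB Require Import structures.
From mathcomp Require Import all_boot all_order all_algebra.
From mathcomp Require Import all_classical all_reals.
From mathcomp Require Import ereal topology normedtype convex.
From mathcomp Require Import ring lra.

Import Order.TTheory GRing.Theory Num.Theory.
Import numFieldNormedType.Exports.

Local Open Scope classical_set_scope.
Local Open Scope ring_scope.

(* The projection steps are characterised by variational inequalities, which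
   together with the subgradient inequalities bound the per-iteration gap by a
   telescoping term plus an error [a b - b^2 / (2 d)] in the step length [b],
   absorbed by Young's inequality into [d a^2 / 2].  The extrapolated term
   [zeta_t - zeta_(t-1)] also telescopes up to such an error.  Summing, the total
   gap over [T] iterations is at most [K sqrt T], and subgradients at the averaged
   iterates transfer the bound to the averages, so that [C = K^2] works. *)

(** * Euclidean geometry, projections and averages *)

Section EuclideanTheory.
Context {R : realType} {n : nat}.
Implicit Types (u v w p q : 'rV[R]_n) (S : set 'rV[R]_n).

Lemma dotpC u v : dotp u v = dotp v u.
Proof. by apply: eq_bigr => i _; rewrite mulrC. Qed.

Lemma dotpDl u v w : dotp (u + v) w = dotp u w + dotp v w.
Proof. by rewrite -big_split; apply: eq_bigr => i _; rewrite mxE mulrDl. Qed.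

Lemma dotpZl a u v : dotp (a *: u) v = a * dotp u v.
Proof. by rewrite mulr_sumr; apply: eq_bigr => i _; rewrite mxE mulrA. Qed.

Lemma dotp0l v : dotp 0 v = 0.
Proof. by apply: big1 => i _; rewrite mxE mul0r. Qed.

Lemma dotpNl u v : dotp (- u) v = - dotp u v.
Proof. by rewrite -scaleN1r dotpZl mulN1r. Qed.

Lemma dotpBl u v w : dotp (u - v) w = dotp u w - dotp v w.
Proof. by rewrite dotpDl dotpNl. Qed.

Lemma dotpDr u v w : dotp u (v + w) = dotp u v + dotp u w.
Proof. by rewrite ![dotp u _]dotpC dotpDl. Qed.

Lemma dotpZr a u v : dotp u (a *: v) = a * dotp u v.
Proof. by rewrite ![dotp u _]dotpC dotpZl. Qed.

Lemma dotpNr u v : dotp u (- v) = - dotp u v.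
Proof. by rewrite ![dotp u _]dotpC dotpNl. Qed.

Lemma dotpBr u v w : dotp u (v - w) = dotp u v - dotp u w.
Proof. by rewrite dotpDr dotpNr. Qed.

Lemma dotp_sqrB u v : dotp (u - v) (u - v) = dotp u u - dotp u v *+ 2 + dotp v v.
Proof. rewrite !(dotpBl, dotpBr) (dotpC v u); ring. Qed.

Definition dotpE := (dotpDl, dotpDr, dotpNl, dotpNr, dotpZl, dotpZr).

Lemma dotp_suml (I : finType) (F : I -> 'rV[R]_n) v :
  dotp (\sum_i F i) v = \sum_i dotp (F i) v.
Proof.
elim/big_ind2: _ => [|a a' b b' <- <-|//]; last by rewrite dotpDl.
exact: dotp0l.
Qed.

Lemma dotp_ge0 u : 0 <= dotp u u.
Proof. by apply: sumr_ge0 => i _; rewrite -expr2 sqr_ge0. Qed.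

Lemma norm2_ge0 u : 0 <= norm2 u.
Proof. exact: sqrtr_ge0. Qed.

Lemma norm2_sqr u : norm2 u ^+ 2 = dotp u u.
Proof. by rewrite sqr_sqrtr ?dotp_ge0. Qed.

Lemma norm2N u : norm2 (- u) = norm2 u.
Proof. by rewrite /norm2 dotpNl dotpNr opprK. Qed.

Lemma dotp_norm2_eq0 u v : norm2 u = 0 -> dotp u v = 0.
Proof.
move=> u0; have /eqP: dotp u u = 0 by rewrite -norm2_sqr u0 expr0n.
rewrite psumr_eq0 => [/allP u0i|i _]; last by rewrite -expr2 sqr_ge0.
apply: big1 => i _; have := u0i i (mem_index_enum i).
by rewrite mulf_eq0 orbb => /eqP ->; rewrite mul0r.
Qed.

(** Cauchy-Schwarz: expand the non-negative square of [norm2 v *: u - norm2 u *: v] and divide by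
    the product of the norms. The degenerate cases are split off to make this division
    legitimate. *)
Lemma dotp_le_norm2 u v : dotp u v <= norm2 u * norm2 v.
Proof.
have [/dotp_norm2_eq0->|u0] := eqVneq (norm2 u) 0.
  by rewrite mulr_ge0 ?norm2_ge0.
have [/dotp_norm2_eq0 v0|v0] := eqVneq (norm2 v) 0.
  by rewrite dotpC v0 mulr_ge0 ?norm2_ge0.
have ugt0 : 0 < norm2 u by rewrite lt_neqAle eq_sym u0 norm2_ge0.
have vgt0 : 0 < norm2 v by rewrite lt_neqAle eq_sym v0 norm2_ge0.
have := dotp_ge0 (norm2 v *: u - norm2 u *: v).
rewrite !dotpE (dotpC v u) -!norm2_sqr => h.
have uv : 0 < norm2 u * norm2 v by apply: mulr_gt0.
rewrite -(ler_pM2l uv); lra.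
Qed.

Lemma dotp_le u v (a : R) : norm2 u <= a -> dotp u v <= a * norm2 v.
Proof.
by move=> ua; rewrite (le_trans (dotp_le_norm2 u v))// ler_wpM2r ?norm2_ge0.
Qed.

Lemma norm2D u v : norm2 (u + v) <= norm2 u + norm2 v.
Proof.
rewrite -(@ler_pXn2r _ 2) ?nnegrE ?addr_ge0 ?norm2_ge0//.
have := dotp_le_norm2 u v.
rewrite norm2_sqr sqrrD !norm2_sqr !dotpE (dotpC v u); lra.
Qed.

Lemma norm2Z a u : 0 <= a -> norm2 (a *: u) = a * norm2 u.
Proof.
move=> a0; rewrite /norm2 dotpZl dotpZr mulrA -expr2 sqrtrM ?sqr_ge0//.
by rewrite sqrtr_sqr ger0_norm.
Qed.

Lemma norm2_sum (I : finType) (F : I -> 'rV[R]_n) :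
  norm2 (\sum_i F i) <= \sum_i norm2 (F i).
Proof.
elim/big_ind2: _ => [|a a' b b' ha hb|//]; last first.
  by rewrite (le_trans (norm2D _ _))// lerD.
by rewrite -(scale0r 0) norm2Z// mul0r.
Qed.

(** [compact_bounded] speaks of the sup norm; passing to the Euclidean norm costs a factor sqrt n,
    which gives [C]. The diameter bound is [C + C], plus 1 for strict positivity. *)
Lemma compact_norm2_bounded S : compact S ->
  exists2 B, 0 < B & forall u v, S u -> S v -> norm2 (u - v) <= B.
Proof.
move=> /compact_bounded[A [_ Abnd]].
pose K := `|A| + 1; pose C := Num.sqrt (K ^+ 2 *+ n).
have bnd u : S u -> norm2 u <= C.
  move=> Su; rewrite ler_sqrt; last by rewrite mulrn_wge0 ?sqr_ge0.
  have -> : K ^+ 2 *+ n = \sum_(i < n) K ^+ 2 by rewrite sumr_const card_ord.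
  apply: ler_sum => i _; rewrite -expr2 -real_normK ?num_real//.
  rewrite lerXn2r ?nnegrE// ?addr_ge0//.
  have uK : `|u| <= K by apply: Abnd => //; rewrite /K ltr_pwDr ?ler_norm.
  apply: le_trans uK; rewrite [leRHS]/Num.norm /= mx_normrE.
  by apply/bigmax_geP; right => /=; exists (0, i).
exists (C + C + 1) => [|u v Su Sv].
  by rewrite ltr_wpDl// addr_ge0// sqrtr_ge0.
rewrite (le_trans (norm2D _ _))// norm2N ler_wpDr//.
by rewrite lerD ?bnd.
Qed.

Lemma convex_setP S u v (a : R) : convex_set S -> 0 <= a <= 1 ->
  S u -> S v -> S (a *: u + (1 - a) *: v).
Proof.
move=> cS /andP[a0 a1] Su Sv.
pose k := @Itv01 R a a0 a1.
by have := cS u v k; rewrite !inE; apply.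
Qed.

(** Variational inequality of the projection. Moving from [p] a fraction [a] towards [q] stays in
    [S], so minimality of [p] gives [b *+ 2 <= a * d] for every [a] in (0, 1]; small [a] then forces
    [b <= 0]. *)
Lemma is_proj_le S v p q : convex_set S -> is_proj S v p -> S q ->
  dotp (v - p) (q - p) <= 0.
Proof.
move=> cS [Sp pmin] Sq; set b := dotp _ _; set d := dotp (q - p) (q - p).
have step a : 0 < a <= 1 -> b *+ 2 <= a * d.
  move=> /andP[a0 a1].
  have Sa : S (a *: q + (1 - a) *: p) by apply: convex_setP; rewrite ?(ltW a0) ?a1.
  have := pmin _ Sa; have -> : v - (a *: q + (1 - a) *: p) = (v - p) - a *: (q - p).
    by apply/rowP => i; rewrite !mxE; ring.
  move=> h; have : norm2 (v - p) ^+ 2 <= norm2 (v - p - a *: (q - p)) ^+ 2.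
    by rewrite lerXn2r ?nnegrE ?norm2_ge0.
  rewrite !norm2_sqr (dotp_sqrB (v - p)) !dotpZr dotpZl -/b -/d => h2.
  rewrite -(ler_pM2l a0); lra.
rewrite leNgt; apply/negP => b0.
have d0 : 0 <= d by apply: dotp_ge0.
have bd : 0 < b + d by rewrite ltr_pwDl.
(* An explicit small fraction replaces the limit [a] to 0: it yields 2 b (b + d) <= b d, impossible
   when b > 0 and d >= 0. *)
have /step : 0 < b / (b + d) <= 1.
  by rewrite divr_gt0// ler_pdivrMr// mul1r lerDl.
rewrite mulrAC ler_pdivlMr//; nra.
Qed.

(** With [u] the current iterate, [v] the next one and [w] the comparison point, this turns the
    variational inequality into telescoping squared distances plus the squared step length. *)
Lemma dotp_three_points u v w :
  dotp (u - v) (w - v) *+ 2 =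
  dotp (u - v) (u - v) + dotp (w - v) (w - v) - dotp (u - w) (u - w).
Proof. rewrite !dotpE (dotpC v u) (dotpC w u) (dotpC w v); ring. Qed.

(** By induction: the average of T+2 points is the convex combination, with weights (T+1)/(T+2) and
    1/(T+2), of the previous average and the last point. *)
Lemma xavg_in S T (x : nat -> 'rV[R]_n) : convex_set S -> (0 < T)%N ->
  (forall t, (0 < t <= T)%N -> S (x t)) -> S (xavg T x).
Proof.
move=> cS; case: T => // T _; elim: T => [|T IH] Sx.
  by rewrite /xavg big_nat1 invr1 scale1r; apply: Sx.
have a0 : 0 <= (T.+1%:R / T.+2%:R : R) by rewrite divr_ge0.
have a1 : T.+1%:R / T.+2%:R <= 1 :> R by rewrite ler_pdivrMr// mul1r ler_nat.
have := @convex_setP S (xavg T.+1 x) (x T.+2) _ cS.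
move=> /(_ (T.+1%:R / T.+2%:R)); rewrite a0 a1 => /(_ isT).
have -> : 1 - T.+1%:R / T.+2%:R = T.+2%:R^-1 :> R.
  have T2 : T.+2%:R != 0 :> R by rewrite pnatr_eq0.
  by rewrite -[X in X - _](divff T2) -mulrBl -natrB// subSnn mul1r.
rewrite /xavg scalerA mulrAC divff ?pnatr_eq0// mul1r -scalerDr -big_nat_recr//.
apply; last by apply: Sx; rewrite ltnS leqnn.
by apply: IH => t /andP[t0 tT]; apply: Sx; rewrite t0 leqW.
Qed.

(** Jensen's inequality from a single affine minorant [p] touching at the average: the deviations
    from the mean sum to zero, so the linear terms cancel. *)
Lemma subgrad_xavg_le (phi : 'rV[R]_n -> R) p T (x : nat -> 'rV[R]_n) :
  (0 < T)%N ->
  (forall t, (t < T)%N ->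
     phi (xavg T x) + dotp p (x t.+1 - xavg T x) <= phi (x t.+1)) ->
  T%:R * phi (xavg T x) <= \sum_(t < T) phi (x t.+1).
Proof.
move=> T0 h; have : \sum_(t < T) (phi (xavg T x) + dotp p (x t.+1 - xavg T x))
    <= \sum_(t < T) phi (x t.+1) by apply: ler_sum => t _; apply: h.
rewrite big_split/= sumr_const card_ord -(mulr_natl (phi _)).
suff -> : \sum_(t < T) dotp p (x t.+1 - xavg T x) = 0 by rewrite addr0.
under eq_bigr do rewrite dotpC.
rewrite -dotp_suml sumrB sumr_const card_ord.
suff -> : \sum_(t < T) x t.+1 = xavg T x *+ T.
  by rewrite subrr dotp0l.
rewrite /xavg -scaler_nat scalerA divff ?scale1r ?pnatr_eq0 -?lt0n//.
by rewrite big_add1/= big_mkord.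
Qed.

End EuclideanTheory.

(** * Regret bounds for the dual and primal updates *)

Section Regret.
Context {R : realType} {n : nat}.
Implicit Types (q : 'rV[R]_n) (S : set 'rV[R]_n).

(** The two sides differ by the square (d a - b)^2 / (2 d). *)
Lemma young_scaled (a b d : R) : 0 < d ->
  a * b - b ^+ 2 / (2 * d) <= d * a ^+ 2 / 2.
Proof.
move=> d0; have -> : d * a ^+ 2 / 2 =
    a * b - b ^+ 2 / (2 * d) + (d * a - b) ^+ 2 / (2 * d).
  by field; rewrite gt_eqF.
by rewrite lerDl divr_ge0 ?sqr_ge0// mulr_ge0// ltW.
Qed.

Lemma norm2_diff_sqr_le S (B : R) (u v q : 'rV[R]_n) :
  (forall u v, S u -> S v -> norm2 (u - v) <= B) -> S u -> S v -> S q ->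
  norm2 (u - q) ^+ 2 - norm2 (v - q) ^+ 2 <= B ^+ 2.
Proof.
move=> hB Su Sv Sq; rewrite lerBlDr ler_wpDr ?sqr_ge0//.
have uq := hB _ _ Su Sq.
by rewrite lerXn2r ?nnegrE ?norm2_ge0// (le_trans _ uq) ?norm2_ge0.
Qed.

(** Regret of one block of the z-update, where [phi t] stands for [- g m (x t)]. The potential [a]
    combines the squared distance to [q] with the inner product of the previous subgradient, so that
    the extrapolation [2 *: zeta t - zeta t.-1] telescopes as well. *)
Lemma dual_regret (T : nat) S (phi : nat -> 'rV[R]_n -> R)
    (z zeta : nat -> 'rV[R]_n) (lam delta E B : R) q :
  convex_set S -> 0 < delta -> 0 <= lam -> (0 < T)%N ->
  (forall u v, S u -> S v -> norm2 (u - v) <= B) ->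
  (forall t, (t <= T)%N -> S (z t)) -> S q ->
  (forall t, (t < T)%N -> is_proj S
     (z t - (delta * lam) *: (2 *: zeta t - zeta t.-1)) (z t.+1)) ->
  (forall t, (t < T)%N -> phi t (z t) + dotp (zeta t) (q - z t) <= phi t q) ->
  (forall t, (t < T)%N -> norm2 (zeta t) <= E) ->
  (forall t, (t < T)%N ->
     phi t (z t.+1) - phi t (z t) <= E * norm2 (z t.+1 - z t)) ->
  \sum_(t < T) lam * (phi t (z t.+1) - phi t q) <=
    B ^+ 2 / (2 * delta) + 2 * lam * E * B
    + T%:R * (9 / 2 * delta * lam ^+ 2 * E ^+ 2).
Proof.
move=> cS d0 l0 T0 hB Sz Sq zP subg zE lip.
(* At t = 0 the junk value [0.-1 = 0] is the convention zeta_(-1) = zeta_0. *)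
pose a t := lam * dotp (zeta t.-1) (q - z t) - norm2 (z t - q) ^+ 2 / (2 * delta).
set e := 9 / 2 * _ * _ * _.
have step t : (t < T)%N ->
    lam * (phi t (z t.+1) - phi t q) <= (a t.+1 - a t) + e.
  move=> tT; have := is_proj_le _ _ _ _ cS (zP t tT) Sq.
  have tT' : (t.-1 < T)%N by rewrite (leq_ltn_trans (leq_pred t)).
  have := subg t tT; have := lip t tT.
  have := dotp_le (- zeta t) (z t.+1 - z t) E; rewrite norm2N => /(_ (zE t tT)).
  have := dotp_le (zeta t.-1) (z t.+1 - z t) E (zE _ tT').
  have := dotp_three_points (z t) (z t.+1) q.
  rewrite -!norm2_sqr -(norm2N (z t - z t.+1)) opprB -(norm2N (q - z t.+1)) opprB.
  rewrite /a; set nd := norm2 (z t.+1 - z t); set r' := norm2 (z t.+1 - q).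
  set r := norm2 (z t - q) => h3 h1 h2 hl hs.
  have -> : z t - (delta * lam) *: (2 *: zeta t - zeta t.-1) - z t.+1 =
     (z t - z t.+1) - (delta * lam) *: (2 *: zeta t - zeta t.-1).
    by rewrite addrAC.
  rewrite (dotpBl (z t - z t.+1)) dotpZl (dotpBl (2 *: zeta t)) dotpZl.
  (* Each subgradient is moved to the base point where it is needed: [zeta t.-1] to [z t], to match
     [a t], and [zeta t] to [z t.+1], to match [a t.+1]. Each move costs an inner product with the
     step, at most [E * nd]. *)
  have eA' : dotp (zeta t.-1) (q - z t.+1) =
     dotp (zeta t.-1) (q - z t) - dotp (zeta t.-1) (z t.+1 - z t).
    by rewrite -dotpBr; congr dotp; apply/rowP => i; rewrite !mxE; ring.
  have eA : dotp (zeta t) (q - z t) =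
     dotp (zeta t) (q - z t.+1) - dotp (- zeta t) (z t.+1 - z t).
    by rewrite dotpNl opprK -dotpDr; congr dotp;
      apply/rowP => i; rewrite !mxE; ring.
  move: hs; rewrite eA eA' /=.
  move: h1 h2 h3; move: (dotp (zeta t.-1) _) (dotp (- zeta t) _) (dotp (zeta t) _).
  move: (dotp (zeta t.-1) _) (dotp _ _) => A' P P1 P2 A h1 h2 h3 hs hP.
  have hP' : (nd ^+ 2 + r' ^+ 2 - r ^+ 2) / (2 * delta) <=
      lam * (2 * A - (A' - P1)).
    rewrite ler_pdivrMr ?mulr_gt0//; lra.
  have hl' : lam * (phi t (z t.+1) - phi t q) <= lam * (2 * E * nd - A).
    by rewrite ler_wpM2l//; lra.
  have h1' : lam * P1 <= lam * (E * nd) by rewrite ler_wpM2l.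
  (* Three errors [lam * E * nd] occur: two from moving the subgradients and one from the Lipschitz
     bound on [phi t]. Young's inequality absorbs them into the squared step, whence the 9 / 2 in
     [e]. *)
  have hy := young_scaled (3 * lam * E) nd delta d0.
  rewrite /e; move: hP' hl' h1' hy; rewrite !mulrDl !mulNr; lra.
apply: (@le_trans _ _ (\sum_(t < T) ((a t.+1 - a t) + e))).
  by apply: ler_sum => t _; apply: step.
rewrite big_split/= sumr_const card_ord -(mulr_natl e) lerD2r.
rewrite -(big_mkord xpredT (fun t => a t.+1 - a t)) telescope_sumr// /a /=.
have E0 : 0 <= E by rewrite (le_trans _ (zE 0%N T0)) ?norm2_ge0.
have B0 t : (t <= T)%N -> E * norm2 (q - z t) <= E * B.
  by move=> tT; apply: ler_wpM2l => //; apply: hB => //; exact: Sz.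
(* Besides the distances, telescoping leaves one inner product at each end; each is at most [E * B],
   which accounts for [2 * lam * E * B]. *)
have hT : dotp (zeta T.-1) (q - z T) <= E * B.
  by rewrite (le_trans (dotp_le _ _ _ (zE _ _))) ?B0// ltn_predL.
have h0 : dotp (- zeta 0%N) (q - z 0%N) <= E * B.
  have := dotp_le (- zeta 0%N) (q - z 0%N) E; rewrite norm2N => /(_ (zE _ T0)).
  by move=> /le_trans; apply; exact: B0.
rewrite dotpNl in h0.
have hT' := ler_wpM2l l0 hT; have h0' := ler_wpM2l l0 h0.
have := norm2_diff_sqr_le _ _ _ _ _ hB (Sz 0%N isT) (Sz T (leqnn _)) Sq.
have i0 : 0 <= (2 * delta)^-1 by rewrite invr_ge0 mulr_ge0// ltW.
move=> /(ler_wpM2r i0); lra.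
Qed.

(** Here [psi t] is meant for the objective at the new dual iterate and [h] for the objective at the
    comparison dual point, both without the proximal term. The difference [h (x t.+1) - h (x t)] is
    included because the dual regret is evaluated at [x t], while the average runs over [x t.+1]. *)
Lemma primal_regret (T : nat) S (psi : nat -> 'rV[R]_n -> R) (h : 'rV[R]_n -> R)
    (x xi : nat -> 'rV[R]_n) (xk : 'rV[R]_n) (alpha gamma L B : R) q :
  convex_set S -> 0 < alpha -> 0 < gamma ->
  (forall u v, S u -> S v -> norm2 (u - v) <= B) ->
  (forall t, (t <= T)%N -> S (x t)) -> S q ->
  (forall t, (t < T)%N -> is_proj S
     ((alpha * gamma / (alpha + gamma)) *:
        (alpha^-1 *: xk + gamma^-1 *: x t - xi t)) (x t.+1)) ->
  (forall t, (t < T)%N -> psi t (x t) + dotp (xi t) (q - x t) <= psi t q) ->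
  (forall t, (t < T)%N -> norm2 (xi t) <= L) ->
  (forall t, (t < T)%N -> h (x t.+1) - h (x t) <= L * norm2 (x t.+1 - x t)) ->
  \sum_(t < T) (psi t (x t) - psi t q + (h (x t.+1) - h (x t))
     + (2 * alpha)^-1 * (norm2 (x t.+1 - xk) ^+ 2 + norm2 (x t.+1 - q) ^+ 2
                         - norm2 (xk - q) ^+ 2)) <=
    B ^+ 2 / (2 * gamma) + T%:R * (2 * gamma * L ^+ 2).
Proof.
move=> cS a0 g0 hB Sx Sq xP subg xL lip.
pose a t := - (norm2 (x t - q) ^+ 2 / (2 * gamma)).
set e := 2 * _ * _.
have g0' : 0 <= (2 * gamma)^-1 by rewrite invr_ge0 mulr_ge0// ltW.
apply: (@le_trans _ _ (\sum_(t < T) ((a t.+1 - a t) + e))).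
  apply: ler_sum => -[t tT] _ /=.
  have := is_proj_le _ _ _ _ cS (xP t tT) Sq.
  have := subg t tT; have := lip t tT.
  have := dotp_le (- xi t) (x t.+1 - x t) L; rewrite norm2N => /(_ (xL t tT)).
  have := dotp_three_points (x t) (x t.+1) q.
  have := dotp_three_points xk (x t.+1) q.
  rewrite -!norm2_sqr !(dotpBl _ (x t.+1) (q - x t.+1)).
  rewrite -(norm2N (x t - x t.+1)) opprB -(norm2N (q - x t.+1)) opprB.
  rewrite -(norm2N (xk - x t.+1)) opprB dotpZl (dotpBl _ (xi t)) dotpDl !dotpZl.
  have -> : dotp (- xi t) (x t.+1 - x t) =
     dotp (xi t) (q - x t.+1) - dotp (xi t) (q - x t).
    by rewrite dotpNl -dotpBr -dotpNr; congr dotp;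
      apply/rowP => i; rewrite !mxE; ring.
  rewrite /a /e; move: (dotp xk _) (dotp (x t) _) (dotp (xi t) _) (dotp (xi t) _).
  move: (dotp (x t.+1) _) => X3 X1 X2 Y' Y h1 h2 h3 h4 h5.
  (* This factor undoes the scaling in the projected point. It equals 1/alpha + 1/gamma, so the
     inequality splits into a proximal part around [xk] and a step part around [x t], each treated
     by the three-point identity. *)
  have ag : 0 < (alpha + gamma) / (alpha * gamma).
    by rewrite divr_gt0 ?addr_gt0 ?mulr_gt0.
  rewrite -(pmulr_rle0 _ ag).
  have -> : (alpha + gamma) / (alpha * gamma) *
     (alpha * gamma / (alpha + gamma) *
        (alpha^-1 * X1 + gamma^-1 * X2 - Y) - X3) =
     (2 * alpha)^-1 * ((X1 - X3) *+ 2) + (2 * gamma)^-1 * ((X2 - X3) *+ 2) - Y.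
    by field; rewrite !gt_eqF ?addr_gt0.
  rewrite h1 h2 => h6.
  (* One [L] comes from the subgradient along the step, the other from the Lipschitz bound on
     [h]. *)
  have := young_scaled (2 * L) (norm2 (x t.+1 - x t)) gamma g0.
  lra.
rewrite big_split/= sumr_const card_ord -(mulr_natl e) lerD2r.
rewrite -(big_mkord xpredT (fun t => a t.+1 - a t)) telescope_sumr// /a /=.
have := norm2_diff_sqr_le _ _ _ _ _ hB (Sx 0%N isT) (Sx T (leqnn _)) Sq.
move=> /(ler_wpM2r g0'); lra.
Qed.

End Regret.

(** * Real-valued consequences of subgradient inequalities *)

Section Subdifferential.
Context {R : realType} {n : nat}.
Implicit Types (u v a p : 'rV[R]_n) (S : set 'rV[R]_n) (f : 'rV[R]_n -> \bar R).

Lemma subdiff_fine f u v p : f u \is a fin_num -> f v \is a fin_num ->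
  subdiff f u p -> fine (f u) + dotp p (v - u) <= fine (f v).
Proof.
by move=> fu fv /(_ v); rewrite -{1}(fineK fu) -{1}(fineK fv) -EFinD lee_fin.
Qed.

(** Apply a subgradient at [u] to the point [v] and bound the linear term by Cauchy-Schwarz. *)
Lemma subdiff_bounded_lipschitz S f (D : R) u v :
  S `<=` edom f -> subdifferentiable_on S f ->
  (forall u p, S u -> subdiff f u p -> norm2 p <= D) -> S u -> S v ->
  fine (f u) - fine (f v) <= D * norm2 (u - v).
Proof.
move=> Sf sub bnd Su Sv; have [p pu] := sub u Su.
have := subdiff_fine f u v p (Sf _ Su) (Sf _ Sv) pu.
have := dotp_le p (u - v) D (bnd _ _ Su pu).
rewrite -(opprB u v) dotpNr; lra.
Qed.

(** Supplies the gradient of the squared distance to [a], so that [subgrad_xavg_le] covers the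
    quadratic terms. *)
Lemma norm2_sqr_subgrad a u v :
  norm2 (u - a) ^+ 2 + dotp (2 *: (u - a)) (v - u) <= norm2 (v - a) ^+ 2.
Proof.
have := dotp_ge0 (v - u); rewrite !norm2_sqr dotpZl.
rewrite !dotpE (dotpC v u) (dotpC a u) (dotpC a v); lra.
Qed.

End Subdifferential.

(** The two kinds of regret terms grow like 1/d and like T d. The lower bound on [d] controls the
    first and the upper bound the second, so both are of order sqrt T. *)
Lemma step_size_bounds {R : realType} (c d b : R) (T : nat) :
  0 < c -> 0 <= b -> (0 < T)%N ->
  c / Num.sqrt T%:R <= d -> d <= 1 / Num.sqrt T%:R ->
  b / (2 * d) <= Num.sqrt T%:R * (b / (2 * c)) /\ T%:R * d <= Num.sqrt T%:R.
Proof.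
move=> c0 b0 T0; have T0' : 0 < T%:R :> R by rewrite ltr0n.
have s0 : 0 < Num.sqrt T%:R :> R by rewrite sqrtr_gt0.
have : Num.sqrt T%:R ^+ 2 = T%:R :> R by rewrite sqr_sqrtr// ltW.
move: (Num.sqrt _) s0 => s s0 sT; rewrite ler_pdivrMr// ler_pdivlMr// => lo hi.
have d0 : 0 < d by rewrite -(pmulr_lgt0 _ s0) (lt_le_trans c0).
split; last by rewrite -sT expr2; nra.
rewrite ler_pdivrMr ?mulr_gt0//.
have -> : s * (b / (2 * c)) * (2 * d) = b * (d * s) / c.
  by field; rewrite gt_eqF.
by rewrite ler_pdivlMr// ler_wpM2l.
Qed.

(** * The saddle-point bound for the averaged iterates *)

Theorem theorem2 (R : realType) (N M : nat) (J : 'I_M -> nat)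
  (X : set 'rV[R]_N) (Z : forall m : 'I_M, set 'rV[R]_(J m))
  (f0 : 'rV[R]_N -> \bar R)
  (g : forall m : 'I_M, 'rV[R]_N -> 'rV[R]_(J m) -> \bar R)
  (X_neq0 : X !=set0) (X_compact : compact X) (X_convex : convex_set X)
  (Z_neq0 : forall m, Z m !=set0) (Z_compact : forall m, compact (Z m))
  (Z_convex : forall m, convex_set (Z m))
  (f0_ninfty : forall x, f0 x != -oo%E)
  (f0_convex : econvex f0) (f0_dom : X `<=` edom f0)
  (g_convex : forall m z, Z m z -> econvex (fun x => g m x z))
  (g_concave : forall m x, X x -> econcave (g m x))
  (g_dom : forall m, X `*` Z m `<=` edom (fun xz => g m xz.1 xz.2))
  (slater : exists2 xbar, X xbar &
     forall m, (robust_constraint Z g m xbar < 0)%E)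
  (opt : exists2 xopt, feasible X Z g xopt &
     forall x, feasible X Z g x -> (f0 xopt <= f0 x)%E)
  (f0_subdiff : subdifferentiable_on X f0)
  (gx_subdiff : forall m z, Z m z ->
     subdifferentiable_on X (fun x => g m x z))
  (gz_subdiff : forall m x, X x ->
     subdifferentiable_on (Z m) (fun z => - g m x z)%E)
  (D0 : R) (D E : 'I_M -> R) (D0_gt0 : 0 < D0)
  (D_gt0 : forall m, 0 < D m) (E_gt0 : forall m, 0 < E m)
  (f0_bound : forall x xi, X x -> subdiff f0 x xi -> norm2 xi <= D0)
  (gx_bound : forall m x z xi, X x -> Z m z ->
     subdiff (fun y => g m y z) x xi -> norm2 xi <= D m)
  (gz_bound : forall m x z zeta, X x -> Z m z ->
     subdiff (fun y => - g m x y)%E z zeta -> norm2 zeta <= E m)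
  (alpha : R) (xk : 'rV[R]_N) (lam : 'I_M -> R)
  (alpha_gt0 : 0 < alpha) (xk_X : X xk) (lam_ge0 : forall m, 0 <= lam m)
  (c : R) (c_gt0 : 0 < c) :
  exists2 C : R, 0 < C &
    forall (nu gamma delta : R) (T : nat)
      (x : nat -> 'rV[R]_N) (z : nat -> forall m : 'I_M, 'rV[R]_(J m))
      (zeta : nat -> forall m : 'I_M, 'rV[R]_(J m))
      (xi0 : nat -> 'rV[R]_N) (xi : nat -> 'I_M -> 'rV[R]_N),
      0 < nu -> (1 <= T)%N -> 0 < gamma -> 0 < delta ->
      C / nu ^+ 2 <= T%:R ->
      gamma <= 1 / Num.sqrt T%:R -> delta <= 1 / Num.sqrt T%:R ->
      c / Num.sqrt T%:R <= gamma -> c / Num.sqrt T%:R <= delta ->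
      inner_run X Z f0 g alpha xk lam T gamma delta x z zeta xi0 xi ->
      strong_approx_saddle X (Zprod Z) (inner_objective f0 g alpha xk lam)
        alpha^-1 nu (xavg T x) (zavg T z).
Proof.
have [BX BX0 hBX] := compact_norm2_bounded X X_compact.
have /choice[BZ hBZ] : forall m, exists B : R, 0 < B /\
    forall u v, Z m u -> Z m v -> norm2 (u - v) <= B.
  by move=> m; have [B B0 hB] := compact_norm2_bounded _ (Z_compact m); exists B.
(* [L] bounds the aggregated x-subgradients and is also a Lipschitz constant on [X] of the objective
   without its proximal term, for every fixed dual point in [Zprod Z]. *)
pose L := D0 + \sum_m lam m * D m.
(* [KZ m] and [K] are the regret constants left after factoring out sqrt T; the denominators [2 * c]
   come from the lower bound on the step sizes. *)
pose KZ m := BZ m ^+ 2 / (2 * c) + 2 * lam m * E m * BZ m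
  + 9 / 2 * lam m ^+ 2 * E m ^+ 2.
pose K := BX ^+ 2 / (2 * c) + 2 * L ^+ 2 + \sum_m KZ m.
have KZ0 m : 0 <= KZ m.
  have [/ltW B0 _] := hBZ m; have E0 := ltW (E_gt0 m); have c0 := ltW c_gt0.
  by rewrite /KZ !addr_ge0 ?divr_ge0 ?mulr_ge0 ?sqr_ge0.
have K0 : 0 < K.
  rewrite /K -addrA ltr_pwDl// ?divr_gt0 ?exprn_gt0 ?mulr_gt0//.
  by apply: addr_ge0; [rewrite mulr_ge0 ?sqr_ge0 | exact: sumr_ge0].
exists (K ^+ 2); first by rewrite exprn_gt0.
move=> nu gamma delta T x z zeta xi0 xi nu0 T1 g0 d0 hC hg hd hcg hcd.
move=> [rx0 rz0 rzeta rz rxi0 rxi rx].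
have Xx t : (t <= T)%N -> X (x t).
  by case: t => [_|t tT]; [exact: rx0|have [] := rx t tT].
have Zz t m : (t <= T)%N -> Z m (z t m).
  by case: t => [_|t tT]; [exact: rz0|have [] := rz t m tT].
have Xb : X (xavg T x).
  by apply: xavg_in => // t /andP[_ tT]; exact: Xx.
have Zb m : Z m (zavg T z m).
  by apply: xavg_in => // t /andP[_ tT]; exact: Zz.
split=> // q w Xq Zw.
pose fr y := fine (f0 y); pose gr m y v := fine (g m y v).
pose h (v : forall m, 'rV[R]_(J m)) y := fr y + \sum_m lam m * gr m y (v m).
have gfin m y v : X y -> Z m v -> g m y v \is a fin_num.
  by move=> Xy Zv; exact: (g_dom m (y, v) (conj Xy Zv)).
have objE y v : X y -> Zprod Z v -> inner_objective f0 g alpha xk lam y v =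
    (h v y + (2 * alpha)^-1 * norm2 (y - xk) ^+ 2)%:E.
  move=> Xy Zv; rewrite /inner_objective !EFinD -(fineK (f0_dom _ Xy)).
  congr (_ + _ + _)%E; rewrite -sumEFin; apply: eq_bigr => m _.
  by rewrite EFinM fineK// gfin//; exact: Zv.
rewrite !objE // -EFinB -EFinD lee_fin.
set xb := xavg T x in Xb *; set zb := zavg T z in Zb *.
have T0 : 0 < T%:R :> R by rewrite ltr0n.
(* Transfer to the averages: convexity in x here, concavity in z in [havgz], both through
   subgradients at the average. *)
have havgx : T%:R * h w xb <= \sum_(t < T) h w (x t.+1).
  rewrite /h mulrDr big_split/= lerD//.
    have [p pb] := f0_subdiff _ Xb; apply: (subgrad_xavg_le fr p) => // t tT.
    by apply: subdiff_fine => //; apply: f0_dom => //; exact: Xx.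
  rewrite exchange_big mulr_sumr ler_sum// => m _.
  rewrite -mulr_sumr mulrCA ler_wpM2l//.
  have [p pb] := gx_subdiff m _ (Zw m) _ Xb.
  apply: (subgrad_xavg_le (fun y => gr m y (w m)) p) => // t tT.
  apply: (subdiff_fine (fun y => g m y (w m))) => //; apply: gfin => //; exact: Xx.
have havgz : - (T%:R * h zb q) <= - \sum_(t < T) h (z t.+1) q.
  rewrite lerN2 /h mulrDr big_split/= sumr_const card_ord -(mulr_natl (fr q)).
  rewrite lerD2l exchange_big mulr_sumr ler_sum// => m _.
  rewrite -mulr_sumr mulrCA ler_wpM2l// -lerN2 -mulrN -sumrN.
  have [p pb] := gz_subdiff m _ Xq _ (Zb m).
  apply: (subgrad_xavg_le (fun v => - gr m q v) p _ (fun t => z t m)) => // t tT.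
  rewrite /gr -!fineN.
  apply: (subdiff_fine (fun y => - g m q y)%E) => //; rewrite fin_numN.
    exact: gfin.
  by apply: gfin => //; exact: Zz.
(* Used twice: [a = xk] gives the proximal term and [a = q] the strong convexity term of the saddle
   inequality. *)
have havgn a : T%:R * norm2 (xb - a) ^+ 2 <= \sum_(t < T) norm2 (x t.+1 - a) ^+ 2.
  apply: (subgrad_xavg_le (fun y => norm2 (y - a) ^+ 2) (2 *: (xb - a))) => // t _.
  exact: norm2_sqr_subgrad.
have hlip v y y' : Zprod Z v -> X y -> X y' -> h v y - h v y' <= L * norm2 (y - y').
  move=> Zv Xy Xy'; rewrite /h opprD addrACA -sumrB /L mulrDl lerD//.
    exact: (subdiff_bounded_lipschitz X).
  rewrite mulr_suml ler_sum// => m _; rewrite -mulrBr -mulrA ler_wpM2l//.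
  apply: (subdiff_bounded_lipschitz X (fun y => g m y (v m))) => //.
  - by move=> u Xu; apply: gfin => //; exact: Zv.
  - by apply: gx_subdiff; exact: Zv.
  - by move=> u p Xu; apply: gx_bound => //; exact: Zv.
have xisub t : (t < T)%N -> h (z t.+1) (x t)
    + dotp (xi0 t + \sum_(m < M) lam m *: xi t m) (q - x t) <= h (z t.+1) q.
  move=> tT; have Xt := Xx _ (ltnW tT).
  rewrite dotpDl dotp_suml /h addrACA -big_split/= lerD//.
    by apply: subdiff_fine; [exact: f0_dom|exact: f0_dom|exact: rxi0].
  rewrite ler_sum// => m _; rewrite dotpZl -mulrDr ler_wpM2l//.
  have Zt := Zz t.+1 m tT.
  apply: (subdiff_fine (fun y => g m y (z t.+1 m))); last exact: rxi.
    exact: gfin.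
  exact: gfin.
have xibnd t : (t < T)%N -> norm2 (xi0 t + \sum_(m < M) lam m *: xi t m) <= L.
  move=> tT; have Xt := Xx _ (ltnW tT).
  rewrite (le_trans (norm2D _ _))// lerD//; first exact/f0_bound/rxi0.
  rewrite (le_trans (norm2_sum _ _))// ler_sum// => m _.
  by rewrite norm2Z// ler_wpM2l//; apply: gx_bound (rxi _ _ tT) => //; exact: Zz.
have primal := primal_regret T X (fun t => h (z t.+1)) (h w) x
  (fun t => xi0 t + \sum_(m < M) lam m *: xi t m) xk alpha gamma L BX q
  X_convex alpha_gt0 g0 hBX Xx Xq rx xisub xibnd
  (fun t tT => hlip w _ _ Zw (Xx _ tT) (Xx _ (ltnW tT))).
have zetabnd m t : (t < T)%N -> norm2 (zeta t m) <= E m.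
  move=> tT; have tT' := ltnW tT.
  by apply: gz_bound (rzeta _ _ tT); [exact: Xx|exact: Zz].
have dual m : \sum_(t < T) lam m * (gr m (x t) (w m) - gr m (x t) (z t.+1 m)) <=
    BZ m ^+ 2 / (2 * delta) + 2 * lam m * E m * BZ m
    + T%:R * (9 / 2 * delta * lam m ^+ 2 * E m ^+ 2).
  have := dual_regret T (Z m) (fun t y => - gr m (x t) y) (fun t => z t m)
    (fun t => zeta t m) (lam m) delta (E m) (BZ m) (w m) (Z_convex m) d0
    (lam_ge0 m) T1 (hBZ m).2 (fun t tT => Zz t m tT) (Zw m) (fun t tT => rz t m tT).
  have gNfin t y : (t < T)%N -> Z m y -> (- g m (x t) y)%E \is a fin_num.
    by move=> tT Zy; rewrite fin_numN; apply: gfin => //; exact/Xx/ltnW.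
  under eq_bigr do rewrite opprK addrC.
  apply.
  - move=> t tT; rewrite /gr -!fineN.
    apply: (subdiff_fine (fun y => - g m (x t) y)%E); last exact: rzeta.
      by apply: gNfin => //; exact/Zz/ltnW.
    by apply: gNfin => //; exact: Zw.
  - exact: zetabnd.
  - move=> t tT; rewrite /gr -(fineN (g m (x t) (z t.+1 m))).
    rewrite -(fineN (g m (x t) (z t m))); have Xt := Xx _ (ltnW tT).
    apply: (subdiff_bounded_lipschitz (Z m) (fun y => - g m (x t) y)%E).
    + by move=> y Zy; exact: gNfin.
    + exact: gz_subdiff.
    + by move=> u p Zu; exact: gz_bound.
    + exact: Zz.
    + exact/Zz/ltnW.
set s := Num.sqrt T%:R in hg hd hcg hcd.
have s2 : s ^+ 2 = T%:R by rewrite sqr_sqrtr// ltW.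
have s1 : 1 <= s by rewrite -sqrtr1 ler_sqrt ?ler1n// ltW.
have primalK : BX ^+ 2 / (2 * gamma) + T%:R * (2 * gamma * L ^+ 2) <=
    s * (BX ^+ 2 / (2 * c) + 2 * L ^+ 2).
  have [h1 h2] := step_size_bounds c gamma (BX ^+ 2) T c_gt0 (sqr_ge0 _) T1 hcg hg.
  have := ler_wpM2r (sqr_ge0 L) h2; rewrite -/s in h1 *; lra.
have dualK m : BZ m ^+ 2 / (2 * delta) + 2 * lam m * E m * BZ m
    + T%:R * (9 / 2 * delta * lam m ^+ 2 * E m ^+ 2) <= s * KZ m.
  have [h1 h2] := step_size_bounds c delta (BZ m ^+ 2) T c_gt0
    (sqr_ge0 _) T1 hcd hd.
  have l2 := mulr_ge0 (sqr_ge0 (lam m)) (sqr_ge0 (E m)).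
  have := ler_wpM2r l2 h2; have [/ltW B0 _] := hBZ m.
  have E0 := ltW (E_gt0 m).
  (* The boundary term [2 * lam m * E m * BZ m] does not shrink with the step size; [1 <= s] lets it
     be charged to [s * KZ m]. *)
  have := ler_wpM2r (mulr_ge0 (mulr_ge0 (lam_ge0 m) E0) B0) s1.
  rewrite /KZ -/s in h1 *; lra.
have total : \sum_(t < T) (h w (x t.+1) - h (z t.+1) q + (2 * alpha)^-1 *
    (norm2 (x t.+1 - xk) ^+ 2 + norm2 (x t.+1 - q) ^+ 2 - norm2 (xk - q) ^+ 2))
    <= s * K.
  have -> : s * K = s * (BX ^+ 2 / (2 * c) + 2 * L ^+ 2) + \sum_m s * KZ m.
    by rewrite -mulr_sumr -mulrDr.
  apply: le_trans (lerD (le_trans primal primalK)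
    (ler_sum _ (fun m _ => le_trans (dual m) (dualK m)))).
  rewrite exchange_big -big_split/= ler_sum// => t _.
  (* The dual regrets sum to a change of dual point at [x t]. Added to the primal regret, this
     cancels every value at [x t] and leaves [h w (x t.+1) - h (z t.+1) q] plus the quadratic
     terms. *)
  have -> : \sum_m lam m * (gr m (x t) (w m) - gr m (x t) (z t.+1 m)) =
      h w (x t) - h (z t.+1) (x t).
    by rewrite /h opprD addrACA subrr add0r -sumrB; apply: eq_bigr => m _;
      rewrite mulrBr.
  lra.
(* The condition on [T] reads K^2 <= (s nu)^2. Hence the total gap [s * K] is at most [T%:R * nu],
   and dividing by [T] leaves [nu]. *)
have Knu : K <= s * nu.
  have snu : 0 <= s * nu by rewrite mulr_ge0 ?(le_trans ler01 s1)// ltW.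
  move: hC; rewrite ler_pdivrMr ?exprn_gt0// -s2 -exprMn.
  by rewrite ler_pXn2r// nnegrE ltW.
rewrite -(ler_pM2l T0).
have {}total : \sum_(t < T) h w (x t.+1) - \sum_(t < T) h (z t.+1) q
    + (2 * alpha)^-1 * (\sum_(t < T) norm2 (x t.+1 - xk) ^+ 2
       + \sum_(t < T) norm2 (x t.+1 - q) ^+ 2 - T%:R * norm2 (xk - q) ^+ 2)
    <= T%:R * nu.
  have -> : T%:R * nu = s * (s * nu) by rewrite -s2 expr2 mulrA.
  apply: le_trans (_ : s * K <= _); last by rewrite ler_wpM2l// (le_trans ler01 s1).
  move: total; rewrite big_split/= -mulr_sumr !sumrB.
  rewrite [X in _ * (X - _)]big_split/=.
  by rewrite sumr_const card_ord -(mulr_natl (norm2 _ ^+ 2)).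
have a2 : 0 <= (2 * alpha)^-1 by rewrite invr_ge0 mulr_ge0// ltW.
have := ler_wpM2l a2 (havgn xk); have := ler_wpM2l a2 (havgn q).
have -> : alpha^-1 / 2 = (2 * alpha)^-1 by rewrite invfM mulrC.
rewrite -(norm2N (q - xb)) opprB -(norm2N (q - xk)) opprB; lra.
Qed.
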